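(* Suppose $M$ and $N$ are both $n\times n$ Hadamard matrices in dephased form, and are symmetric permutations of the Fourier matrix $\mathcal{F}_n$ (that is, each is a symmetric matrix and is permutationally equivalent to $\mathcal{F}_n$). If $\operatorname{tr}(M)=\operatorname{tr}(N)$, then $M$ and $N$ are spectrally equivalent.
   Context: An $n\times n$ complex matrix $H$ is called a Hadamard matrix if it is unitary and all its entries have complex modulus $\frac{1}{\sqrt n}$. It is in dephased form if all entries of its first row and first column are equal to $\frac{1}{\sqrt n}$. For an integer $n\ge 2$, $\mathcal{F}_n=\frac{1}{\sqrt n}\left(e^{2\pi i jk/n}\right)_{j,k}$ is the Fourier matrix, with rows and columns indexed by $\{0,1,\dots,n-1\}$. Matrices $A$ and $B$ are permutationally equivalent if there are permutation matrices $P$ and $Q$ such that $B=Q^TAP$. Two matrices are spectrally equivalent if their spectra are equal including multiplicity. Symmetric means $M^T=M$. *)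

(* Defs.v *)
From HB Require Import structures.
From mathcomp Require Import all_boot all_order all_algebra.
From mathcomp Require Import spectral complex.
From mathcomp Require Import reals trigo sequences exp.

Set Implicit Arguments.
Unset Strict Implicit.
Unset Printing Implicit Defensive.

Import Order.TTheory GRing.Theory Num.Theory.

Local Open Scope ring_scope.

(* The library has the exponential on R only; this is e ^ z on R[i], via
   e ^ (x + i y) = e ^ x (cos y + i sin y). *)
Definition cexp (R : realType) (z : R[i]) : R[i] :=
  (expR (complex.Re z))%:C%C * (cos (complex.Im z) +i* sin (complex.Im z))%C.

(* `|z| has values in R[i], hence the nonnegative root sqrtC n%:R. *)
Definition hadamard (R : realType) (n : nat) (H : 'M[R[i]]_n) : Prop :=
  H \is unitarymx /\ forall j k : 'I_n, `|H j k| = (sqrtC n%:R)^-1.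

Definition dephased (R : realType) (n : nat) (H : 'M[R[i]]_n) : Prop :=
  forall j k : 'I_n,
    j = 0%N :> nat \/ k = 0%N :> nat -> H j k = (sqrtC n%:R)^-1.

Definition fourier_mx (R : realType) (n : nat) : 'M[R[i]]_n :=
  (sqrtC n%:R)^-1 *:
    \matrix_(j < n, k < n) cexp (2 * (pi : R)%:C%C * 'i%C * (j * k)%:R / n%:R).

Definition perm_equiv (R : realType) (n : nat) (A B : 'M[R[i]]_n) : Prop :=
  exists P Q : 'M[R[i]]_n,
    [/\ is_perm_mx P, is_perm_mx Q & B = Q^T *m A *m P].

(* The multiplicity of an eigenvalue is its algebraic one. *)
Definition spectrally_equiv (R : realType) (n : nat) (A B : 'M[R[i]]_n) : Prop :=
  eigenvalue A =1 eigenvalue B /\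
  forall a : R[i], mup a (char_poly A) = mup a (char_poly B).

(* Main.v *)
(* The trace of M^2 is the sum of the squares of the entries of the symmetric
   matrix M, so it is the same for every symmetric permutation of F_n.  As F_n
   is unitary and symmetric, and conjugation negates its row indices modulo n,
   F_n^2 is the permutation matrix of negation and F_n^4 = 1; since M^2 is a
   conjugate of F_n^2 by a permutation matrix, M^4 = 1.  Thus the eigenvalues
   of M are fourth roots of unity, and the multiplicity of such a root is given
   by Fourier inversion in terms of n, tr M, tr M^2 and tr M^3 = (tr M)^*. *)

Require Import Defs.
From mathcomp Require Import all_boot all_order all_fingroup all_algebra.
From mathcomp Require Import complex reals spectral trigo sequences exp ring.

Set Implicit Arguments.
Unset Strict Implicit.
Unset Printing Implicit Defensive.

Import Order.TTheory GRing.Theory Num.Theory.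

Local Open Scope ring_scope.

Lemma char_poly_similar (F : fieldType) n (P A : 'M[F]_n) :
  P \in unitmx -> char_poly (invmx P *m A *m P) = char_poly A.
Proof.
move=> Pu; rewrite /char_poly.
have VP : map_mx polyC (invmx P) *m map_mx polyC P = 1%:M.
  by rewrite -map_mxM mulVmx // map_mx1.
have -> : char_poly_mx (invmx P *m A *m P) =
    map_mx polyC (invmx P) *m char_poly_mx A *m map_mx polyC P.
  rewrite /char_poly_mx mulmxBr mulmxBl !map_mxM /= mul_mx_scalar.
  by rewrite -scalemxAl VP scalemx1.
by rewrite !det_mulmx mulrAC -det_mulmx VP det1 mul1r.
Qed.

(** The spectral theorem makes [A] similar to a diagonal matrix, whose diagonal is [d]; powers,
    traces and the characteristic polynomial are then read off there. *)
Lemma normalmx_order4 (C : numClosedFieldType) n (A : 'M[C]_n) :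
  A \is normalmx -> A *m A *m (A *m A) = 1%:M ->
  exists d : 'I_n -> C,
    [/\ forall i, d i ^+ 4 = 1, \tr A = \sum_i d i,
        \tr (A *m A) = \sum_i d i ^+ 2 &
        char_poly A = \prod_i ('X - (d i)%:P)].
Proof.
move=> /orthomx_spectralP; have := spectral_unit A.
move: (spectralmx A) (spectral_diag A) => P D Pu defA A4.
have mulA (X Y : 'M_n) :
    (invmx P *m X *m P) *m (invmx P *m Y *m P) = invmx P *m (X *m Y) *m P.
  by rewrite !mulmxA mulmxK.
exists (D 0); split.
- move=> i; move: A4; rewrite defA !mulA !mulmx_diag.
  move=> /(congr1 (fun X => P *m X *m invmx P)).
  rewrite mulmx1 mulmxV // mulmxA mulmxK // mulKVmx //.
  move=> /matrixP/(_ i i); rewrite !mxE eqxx !mulr1n => <-.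
  by rewrite !exprS expr0 !mulrA mulr1.
- by rewrite defA mxtrace_mulC mulKVmx // mxtrace_diag.
- rewrite defA mulA mxtrace_mulC mulKVmx // mulmx_diag mxtrace_diag.
  by apply: eq_bigr => i _; rewrite mxE expr2.
- rewrite defA char_poly_similar // char_poly_trig ?diag_mx_is_trig //.
  by apply: eq_bigr => i _; rewrite mxE eqxx.
Qed.

Lemma conjC_order4 (C : numClosedFieldType) (x : C) :
  x ^+ 4 = 1 -> x^* = x ^+ 3.
Proof.
move=> x4; have n1 : `|x| = 1.
  by apply/eqP; rewrite -(@pexpr_eq1 _ _ 4) // -normrX x4 normr1.
have x0 : x != 0 by rewrite -normr_gt0 n1.
by apply: (mulfI x0); rewrite -normCK n1 expr1n -exprS x4.
Qed.

(* Discrete Fourier inversion on the group of fourth roots of unity. *)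
Lemma indicator_order4 (C : numClosedFieldType) (a x : C) :
  a ^+ 4 = 1 -> x ^+ 4 = 1 ->
  4 * (x == a)%:R = 1 + a ^+ 3 * x + a ^+ 2 * x ^+ 2 + a * x^*.
Proof.
move=> a4 x4; rewrite conjC_order4 //; case: eqVneq => [->|xa].
  transitivity (1 + 3 * a ^+ 4); first by rewrite a4 mulr1n; ring.
  by ring.
(* The second factor is the geometric sum in [x / a], because [a ^+ 3] is the inverse of [a];
   multiplying by [x - a] makes it telescope. *)
have: (x - a) * (1 + a ^+ 3 * x + a ^+ 2 * x ^+ 2 + a * x ^+ 3) = 0.
  transitivity (a * (x ^+ 4 - 1) + (1 - a ^+ 4) * x); first by ring.
  by rewrite a4 x4 !subrr mulr0 mul0r addr0.
by move/eqP; rewrite mulf_eq0 subr_eq0 (negPf xa) /= => /eqP ->; rewrite mulr0.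
Qed.

(** Sum [indicator_order4] over the family. The third power sum enters as the conjugate of the
    first, so two power sums fix all multiplicities. *)
Lemma count_order4 (C : numClosedFieldType) n (d : 'I_n -> C) (a : C) :
  (forall i, d i ^+ 4 = 1) -> a ^+ 4 = 1 ->
  4 * (count_mem a (codom d))%:R =
  n%:R + a ^+ 3 * (\sum_i d i) + a ^+ 2 * (\sum_i d i ^+ 2)
    + a * (\sum_i d i)^*.
Proof.
move=> d4 a4.
have -> : count_mem a (codom d) = (\sum_i (d i == a))%N.
  rewrite codomE count_map -sum1_count big_mkcond big_enum /=.
  by apply: eq_bigr => i _; case: eqP.
rewrite natr_sum rmorph_sum /= !mulr_sumr.
have -> : n%:R = \sum_(i < n) (1 : C) by rewrite sumr_const card_ord.
by rewrite -!big_split /=; apply: eq_bigr => i _; apply: indicator_order4.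
Qed.

Lemma char_poly_order4 (C : numClosedFieldType) n (A B : 'M[C]_n) :
  A \is normalmx -> B \is normalmx ->
  A *m A *m (A *m A) = 1%:M -> B *m B *m (B *m B) = 1%:M ->
  \tr A = \tr B -> \tr (A *m A) = \tr (B *m B) ->
  char_poly A = char_poly B.
Proof.
move=> nA nB /(normalmx_order4 nA) [d [d4 -> -> ->]].
move=> /(normalmx_order4 nB) [e [e4 -> -> ->]] eq1 eq2.
have perm_de : perm_eq (codom d) (codom e).
  (* [perm_eq] compares counts only at members of the two lists, so each [a] tested is a fourth root
     of unity. *)
  apply/allP => a a_de; apply/eqP.
  apply: (@mulrIn C 1); first by rewrite oner_eq0.
  have a4 : a ^+ 4 = 1.
    by move: a_de; rewrite mem_cat => /orP[] /codomP[i ->].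
  by apply: (@mulfI _ 4); rewrite ?pnatr_eq0 // !count_order4 // eq1 eq2.
have prodE (f : 'I_n -> C) :
    \prod_i ('X - (f i)%:P) = \prod_(x <- codom f) ('X - x%:P).
  by rewrite codomE big_map big_enum.
by rewrite !prodE; apply: perm_big.
Qed.

Lemma fourier_order4 (C : numClosedFieldType) n (w c : C) (F : 'M[C]_n) :
  `|w| = 1 -> w ^+ n = 1 -> c \is Num.real ->
  F = c *: \matrix_(j, k) w ^+ (j * k) -> F \is unitarymx ->
  F *m F *m (F *m F) = 1%:M.
Proof.
case: n F => [|n] F w1 wn cR defF Fu; first by apply/matrixP => [[]].
have w0 : w != 0 by rewrite -normr_gt0 w1.
have wJ : w^* = w^-1 by rewrite invC_norm w1 expr1n invr1 mul1r.
(* With indices in Z/(n+1), column [k] of [F] is the conjugate of row [- k], so entry [(j, k)] of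
   the square is entry [(j, - k)] of [F] times its adjoint, which is the identity. *)
have F2 : F *m F = \matrix_(j, k) (j == - k)%:R.
  apply/matrixP => j k; have /unitarymxP/matrixP/(_ j (- k)) := Fu.
  rewrite !mxE => <-; apply: eq_bigr => l _.
  rewrite defF !mxE rmorphM /= (CrealP cR) rmorphXn /= wJ; congr (_ * (_ * _)).
  apply: (@mulIf _ (w ^+ ((n.+1 - k) * l))); first by rewrite expf_neq0.
  (* The ordinal [- k] has value [n.+1 - k] reduced modulo [n.+1]; the reduction matters at [k = 0]
     and is absorbed by [wn]. *)
  have -> : (w^-1) ^+ (- k * l) = (w^-1) ^+ ((n.+1 - k) * l).
    rewrite !exprM; congr (_ ^+ l); apply: expr_mod.
    by rewrite exprVn wn invr1.
  rewrite -exprMn mulVf // expr1n [(l * k)%N]mulnC -exprD -mulnDl.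
  by rewrite subnKC ?(ltnW (ltn_ord k)) // exprM wn expr1n.
rewrite F2; apply/matrixP => j k.
rewrite !mxE (bigD1 (- k)) //= !mxE eqxx mulr1.
by rewrite opprK big1 ?addr0 // => l /negPf lk; rewrite !mxE lk mulr0.
Qed.

Lemma fourier_mxE (R : realType) n : (0 < n)%N ->
  exists w : R[i], [/\ `|w| = 1, w ^+ n = 1 &
    fourier_mx R n = (sqrtC n%:R)^-1 *: \matrix_(j, k) w ^+ (j * k)].
Proof.
move=> n0; pose t : R := 2 * pi / n%:R.
have nz : n%:R != 0 :> R by rewrite pnatr_eq0 -lt0n.
(* De Moivre's formula. *)
have expw m : (cos t +i* sin t)%C ^+ m = (cos (m%:R * t) +i* sin (m%:R * t))%C.
  elim: m => [|m IH]; first by rewrite mul0r cos0 sin0.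
  rewrite exprS IH -[m.+1]add1n natrD mulrDl mul1r cosD sinD.
  by simpc; rewrite [_ * cos (m%:R * t)]mulrC; congr (_ +i* _)%C; ring.
exists (cos t +i* sin t)%C; split.
- by rewrite normc_def cos2Dsin2 sqrtr1.
- by rewrite expw /t mulrCA mulfV // mulr1 mulr_natl cos2pi sin2pi.
- congr (_ *: _); apply/matrixP => j k; rewrite !mxE expw.
  have -> : 2 * (pi : R)%:C%C * 'i%C * (j * k)%:R / n%:R =
      (0 +i* ((j * k)%:R * t))%C.
    transitivity (((j * k)%:R * t)%:C%C * 'i%C : R[i]); last by simpc.
    by rewrite /t !rmorphM /= fmorphV !rmorph_nat; ring.
  by rewrite /cexp /= expR0 mul1r.
Qed.

Lemma mulmx_perm_tr (S : comNzRingType) n (P : 'M[S]_n) :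
  is_perm_mx P -> P *m P^T = 1%:M.
Proof.
by move=> /is_perm_mxP[s ->]; rewrite tr_perm_mx -perm_mxM mulgV perm_mx1.
Qed.

Section SymmetricPermutation.
Variables (C : numClosedFieldType) (n : nat) (A B P Q : 'M[C]_n).
Hypotheses (Pp : is_perm_mx P) (Qp : is_perm_mx Q).
Hypotheses (symA : A^T = A) (symB : B^T = B) (defB : B = Q^T *m A *m P).

(** By symmetry the second factor [B] may be written [B^T], which brings [P] next to [P^T]; these
    cancel and only a conjugation by [Q] remains. *)
Lemma sqr_sym_perm : B *m B = Q^T *m (A *m A) *m Q.
Proof.
rewrite -{2}symB defB !trmx_mul trmxK symA !mulmxA.
by rewrite -[_ *m P *m P^T]mulmxA mulmx_perm_tr // mulmx1.
Qed.

Lemma trace_sqr_sym_perm : \tr (B *m B) = \tr (A *m A).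
Proof.
by rewrite sqr_sym_perm mxtrace_mulC [Q *m _]mulmxA mulmx_perm_tr ?mul1mx.
Qed.

Lemma order4_sym_perm :
  B *m B *m (B *m B) = 1%:M -> A *m A *m (A *m A) = 1%:M.
Proof.
have QQt := mulmx_perm_tr Qp.
have defA2 : A *m A = Q *m (B *m B) *m Q^T.
  rewrite sqr_sym_perm; move: (A *m A) => G.
  by rewrite !mulmxA QQt mul1mx -mulmxA QQt mulmx1.
rewrite defA2; move: (B *m B) => G G2.
rewrite !mulmxA -[_ *m Q^T *m Q]mulmxA (mulmx1C QQt) mulmx1.
by rewrite -[_ *m G *m G]mulmxA G2 mulmx1.
Qed.

Lemma unitarymx_perm : A \is unitarymx -> B \is unitarymx.
Proof.
have permU (S : 'M[C]_n) : is_perm_mx S -> S \is unitarymx.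
  move=> Sp; apply/unitarymxP; rewrite -(mulmx_perm_tr Sp); congr (_ *m _).
  by move: Sp => /is_perm_mxP[s ->]; rewrite tr_perm_mx; exact: map_perm_mx.
move=> Au; rewrite defB; apply: mul_unitarymx; last exact: permU.
by apply: mul_unitarymx => //; rewrite trmx_unitary permU.
Qed.

End SymmetricPermutation.

Theorem corollary6 (R : realType) (n : nat) (hn : (2 <= n)%N)
    (M N : 'M[R[i]]_n)
    (hadM : hadamard M) (hadN : hadamard N)
    (depM : dephased M) (depN : dephased N)
    (symM : M^T = M) (symN : N^T = N)
    (permM : perm_equiv M (fourier_mx R n))
    (permN : perm_equiv N (fourier_mx R n))
    (trMN : \tr M = \tr N) :
  spectrally_equiv M N.
Proof.
(* Eigenvalues and their algebraic multiplicities are both read off the characteristic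
   polynomial. *)
suff eqMN : char_poly M = char_poly N.
  by split=> a; rewrite ?eigenvalue_root_char eqMN.
have [w [w1 wn defF]] := fourier_mxE R (ltnW hn).
have symF : (fourier_mx R n)^T = fourier_mx R n.
  by apply/matrixP => j k; rewrite !mxE mulnC.
have unitary_normal (A : 'M[R[i]]_n) : A \is unitarymx -> A \is normalmx.
  by move=> /unitarymxP AAt; apply/normalmxP; rewrite AAt (mulmx1C AAt).
case: permM permN => [P [Q [Pp Qp defM]]] [P' [Q' [Pp' Qp' defN]]].
have [[Mu _] [Nu _]] := (hadM, hadN).
have sqrtn_real : (sqrtC n%:R)^-1 \is @Num.real R[i].
  by rewrite ger0_real // invr_ge0 sqrtC_ge0 ler0n.
(* The Fourier matrix inherits unitarity from [M], of which it is a permutation, so no sum of roots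
   of unity has to be computed. *)
have F4 := fourier_order4 w1 wn sqrtn_real defF
  (unitarymx_perm Pp Qp defM Mu).
apply: char_poly_order4 => //; try exact: unitary_normal.
- exact: order4_sym_perm Pp Qp symM symF defM F4.
- exact: order4_sym_perm Pp' Qp' symN symF defN F4.
(* Both traces equal that of the squared Fourier matrix. *)
- rewrite -(trace_sqr_sym_perm Pp Qp symM symF defM).
  exact: trace_sqr_sym_perm Pp' Qp' symN symF defN.
Qed.
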